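(* Consider a linear or quasi-linear Fisher market as in the context, and let $\theta\in(0,1)$. The adaptive APM finds competitive equilibrium prices in at most $K$ iterations, where $$K=\max\left\{\left\lceil 2\log_\theta\left(\frac{\sqrt\sigma\,\Delta^*}{6}\right)\right\rceil,\,1\right\};$$ that is, for some $k\le K$ the vector $\hat\mu^k$ satisfies the stopping criterion, and then $p_j=\exp(\hat\mu^k_j)$, $j\in[m]$, are competitive equilibrium prices.
   Context: Market. There are $m\ge1$ goods and $n\ge1$ buyers; $[m]=\{1,\dots,m\}$. Buyer $i$ has budget $B_i>0$, and the utility matrix $v=(v_{ij})\in\mathbb R^{n\times m}$ has nonnegative entries and no zero row or zero column; $v_i$ is the $i$-th row. A parameter $\alpha\in\{1,+\infty\}$ selects utilities: $u_i(x_i)=\sum_jv_{ij}x_{ij}$ (linear) if $\alpha=+\infty$, $u_i(x_i)=\sum_j(v_{ij}-p_j)x_{ij}$ (quasi-linear, at prices $p$) if $\alpha=1$. Conventions: $\alpha^{-1}=0$ if $\alpha=+\infty$; $v_{i0}=1$; $\mu_0=\log\alpha\in\{0,+\infty\}$ (the same for every $\mu$); $\log0=-\infty$; $\max\emptyset=-\infty$. Competitive equilibrium (CE). $p^*\in\mathbb R^m_+$ and $x^*\in\mathbb R^{n\times m}_+$ satisfy CE if (E1) $\sum_jp^*_jx^*_{ij}\le B_i$ for all $i$; (E2) $u_i(x^*_i)=\max\{u_i(x_i):x_i\in\mathbb R^m_+,\ \sum_jp^*_jx_{ij}\le B_i\}$ for all $i$ (utilities at prices $p^*$); (E3) $\sum_ix^*_{ij}\le1$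 for all $j$, with equality if $p^*_j>0$. CE prices are $p^*$ for which such an $x^*$ exists. Objective. $F(\mu)=\sum_{j\in[m]}\exp(\mu_j)+\sum_{i\in[n]}B_ih_i(\mu)$ with $h_i(\mu)=\max_{j\in\{0\}\cup[m]}\{\log(v_{ij})-\mu_j\}$, $\mu\in\mathbb R^m$; $\mu^*$ is its unique minimizer over $\mathbb R^m$. $\mathcal J_i(\mu)=\arg\max_{j\in\{0\}\cup[m]}\{\log(v_{ij})-\mu_j\}$. $\Delta^*=\min_{i\in[n]}\big(h_i(\mu^* )-\max_{j\in(\{0\}\cup[m])\setminus\mathcal J_i(\mu^* )}\{\log(v_{ij})-\mu^*_j\}\big)\in(0,+\infty]$ (if $\Delta^*=+\infty$ then $K=1$). Constants. $\bar p=(1-\alpha^{-1})\|B\|_1+\max_{i,j}\alpha^{-1}v_{ij}$, $\underline p=\min_{j\in[m]}\max_{i\in[n]}\frac{v_{ij}B_i}{\|v_i\|_1+\alpha^{-1}B_i}$, $\underline\mu=\log\underline p$, $\bar\mu=\log\bar p$, $\eta=1$, $\sigma=\exp(\underline\mu-\eta)$. Adaptive APM. Input $\epsilon_k=\theta^k$, $k\ge1$. Iteration $k=1,2,\dots$: (approximate step) run the inner solver APM (an accelerated projected gradient method whose iterates lie in the box $[\underline\mu-\eta,\bar\mu+\eta]^m$) to find $\mu^k$ in this box with $F(\mu^k)-F(\mu^* )\le\epsilon_k$; (recovery step) $\hat\mu^k=\mathcal R(\mu^k,\sqrt{2\epsilon_k/\sigma})$. Stopping criterion: $\hat\mu^k\in\mathbb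 R^m$ satisfies the optimality condition $0\in\partial F(\hat\mu^k)$. Recovery oracle $\mathcal R(\mu,r)$. Put $J_i=\{j\in\{0\}\cup[m]:\log(v_{ij})-\mu_j\ge h_i(\mu)-2r\}$, $i\in[n]$. If $[m]\not\subseteq\bigcup_iJ_i$, return NaN. Otherwise return $\mathcal P(\mathcal E(\{J_i\}_{i\in[n]}))$, where: Classification procedure $\mathcal E$: start with $s=0$, $I^c=[n]$. While $I^c\ne\emptyset$: set $s\leftarrow s+1$; pick $i^s\in I^c$; set $I_s=\{i^s\}$, $I^c\leftarrow I^c\setminus\{i^s\}$, $\tilde J_s=J_{i^s}$, $J_{check}=\emptyset$, $t=1$; while $J_{check}\subsetneq\tilde J_s$: pick $j^s_t\in\tilde J_s\setminus J_{check}$, set $\mathcal I_{new}(j^s_t)=\{i\in I^c:j^s_t\in J_i\}$, $I_s\leftarrow I_s\cup\mathcal I_{new}(j^s_t)$, $I^c\leftarrow I^c\setminus\mathcal I_{new}(j^s_t)$, $\tilde J_s\leftarrow\tilde J_s\cup\bigcup_{i\in\mathcal I_{new}(j^s_t)}J_i$, $J_{check}\leftarrow J_{check}\cup\{j^s_t\}$, $t\leftarrow t+1$. Output $I_l,\tilde J_l,i^l$ ($l\in[s]$) and $j^l_t,\mathcal I_{new}(j^l_t)$ ($t\in[|\tilde J_l|]$, $l\in[s]$). Solution procedure $\mathcal P$ (on the output of $\mathcal E$): for each $l\in[s]$: set $a_{j^l_1}=0$, $J_{done}=J_{i^l}$, and $a_j=\log(v_{i^lj})-\log(v_{i^lj^l_1})$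 for $j\in J_{i^l}$; for $t=1,\dots,|\tilde J_l|$: set $a_j=a_{j^l_t}+\log(v_{ij})-\log(v_{ij^l_t})$ for $j\in J_i\setminus J_{done}$, $i\in\mathcal I_{new}(j^l_t)$, then $J_{done}\leftarrow J_{done}\cup\bigcup_{i\in\mathcal I_{new}(j^l_t)}J_i$. Then set $\mu_{j^l_1}=-a_0$ if $0\in\tilde J_l$, and $\mu_{j^l_1}=\log(\sum_{i\in I_l}B_i)-\log(\sum_{j\in\tilde J_l}\exp(a_j))$ otherwise; and $\mu_j=\mu_{j^l_1}+a_j$ for $j\in\tilde J_l$. Output $\mu=(\mu_j)_{j\in[m]}$. *)

(* Defs.v *)
From mathcomp Require Import all_boot all_order all_algebra.
From mathcomp Require Import boolp classical_sets constructive_ereal reals ereal sequences exp.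
From Stdlib Require List.

Set Implicit Arguments.
Unset Strict Implicit.
Unset Printing Implicit Defensive.

Import Order.TTheory GRing.Theory Num.Theory.
Local Open Scope ring_scope.

(* The index set {0} \cup [m]: [None] is the index 0 (leftover money) and
   [Some j] is the good j. *)
Notation item m := (option 'I_m).

(* Extrema of a finite nonempty real family (junk value 0 on an empty one). *)
Definition rmax (R : realType) (I : finType) (f : I -> R) : R :=
  fine (\big[maxe/-oo%E]_i (f i)%:E).
Definition rmin (R : realType) (I : finType) (f : I -> R) : R :=
  fine (\big[mine/+oo%E]_i (f i)%:E).

Definition logb (R : realType) (b x : R) : R := ln x / ln b.

Definition subdifferential (R : realType) (m : nat)
    (f : 'rV[R]_m -> \bar R) (x : 'rV[R]_m) : set 'rV[R]_m :=
  [set g : 'rV[R]_m | forall y : 'rV[R]_m,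
    (f x + (\sum_j g 0 j * (y 0 j - x 0 j))%:E <= f y)%E]%classic.

Definition is_minimizer (R : realType) (m : nat)
    (f : 'rV[R]_m -> \bar R) (x : 'rV[R]_m) : Prop :=
  forall y, (f x <= f y)%E.

Record fisher_market (R : realType) (m n : nat) := FisherMarket {
  budget : 'I_n -> R;
  value : 'M[R]_(n, m);
  alpha : \bar R;
  budget_gt0 : forall i, 0 < budget i;
  value_ge0 : forall i j, 0 <= value i j;
  value_row_neq0 : forall i, exists j, value i j != 0;
  value_col_neq0 : forall j, exists i, value i j != 0;
  alpha_cases : alpha = 1%E \/ alpha = +oo%E
}.

Section Market.
Context (R : realType) (m n : nat) (M : fisher_market R m n).

(* alpha^-1, with the convention that it is 0 when alpha = +oo *)
Definition alphaV : R := fine (alpha M)^-1%E.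

Definition utility (p : 'rV[R]_m) (i : 'I_n) (x : 'rV[R]_m) : R :=
  if alpha M == +oo%E then \sum_j value M i j * x 0 j
  else \sum_j (value M i j - p 0 j) * x 0 j.

Definition affordable (p : 'rV[R]_m) (i : 'I_n) (x : 'rV[R]_m) : Prop :=
  \sum_j p 0 j * x 0 j <= budget M i.

Definition competitive_equilibrium
    (p : 'rV[R]_m) (x : 'M[R]_(n, m)) : Prop :=
  [/\ (forall j, 0 <= p 0 j) /\ (forall i j, 0 <= x i j),
      forall i, affordable p i (row i x),
      forall i (y : 'rV[R]_m), (forall j, 0 <= y 0 j) -> affordable p i y ->
        utility p i y <= utility p i (row i x) &
      forall j, \sum_i x i j <= 1 /\ (0 < p 0 j -> \sum_i x i j = 1)].

Definition ce_prices (p : 'rV[R]_m) : Prop :=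
  exists x, competitive_equilibrium p x.

Definition value0 (i : 'I_n) (j : item m) : R :=
  if j is Some k then value M i k else 1.

Definition mu0 (mu : 'rV[R]_m) (j : item m) : \bar R :=
  if j is Some k then (mu 0 k)%:E else lne (alpha M).

(* log v_ij - mu_j; here lne 0 = -oo and -oo - +oo = -oo *)
Definition log_ratio (mu : 'rV[R]_m) (i : 'I_n) (j : item m) : \bar R :=
  (lne (value0 i j)%:E - mu0 mu j)%E.

Definition h (mu : 'rV[R]_m) (i : 'I_n) : \bar R :=
  \big[maxe/-oo%E]_(j : item m) log_ratio mu i j.

Definition F (mu : 'rV[R]_m) : \bar R :=
  (\sum_j (expR (mu 0 j))%:E + \sum_i (budget M i)%:E * h mu i)%E.

Definition argmax_items (mu : 'rV[R]_m) (i : 'I_n) : {set item m} :=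
  [set j | log_ratio mu i j == h mu i]%SET.

Definition gap (mu : 'rV[R]_m) : \bar R :=
  \big[mine/+oo%E]_(i : 'I_n)
    (h mu i - \big[maxe/-oo%E]_(j | j \notin argmax_items mu i)
                log_ratio mu i j)%E.

Definition p_upper : R :=
  (1 - alphaV) * (\sum_i `|budget M i|)
  + rmax (fun ij : 'I_n * 'I_m => alphaV * value M ij.1 ij.2).

Definition p_lower : R :=
  rmin (fun j : 'I_m => rmax (fun i : 'I_n =>
    value M i j * budget M i / (\sum_k `|value M i k| + alphaV * budget M i))).

Definition mu_lower : R := ln p_lower.
Definition mu_upper : R := ln p_upper.
Definition eta : R := 1.
Definition sigma : R := expR (mu_lower - eta).

Definition in_box (mu : 'rV[R]_m) : Prop :=
  forall j, mu_lower - eta <= mu 0 j <= mu_upper + eta.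

Record component := Component {
  seed : 'I_n;
  buyers : {set 'I_n};
  items : {set item m};
  (* the pairs (j_t, I_new(j_t)), t = 1, 2, ..., in order *)
  trace : seq (item m * {set 'I_n})
}.

(* State of the inner loop: a partially built component together with the
   pool I^c of unassigned buyers and the set J_check. *)
Record search_state := SearchState {
  partial : component;
  pool : {set 'I_n};
  checked : {set item m}
}.

Definition search_init (J : 'I_n -> {set item m})
    (Ic : {set 'I_n}) (i : 'I_n) : search_state :=
  SearchState (Component i [set i]%SET (J i) [::]) (Ic :\ i)%SET finset.set0.

Definition search_step (J : 'I_n -> {set item m})
    (s : search_state) (j : item m) : search_state :=
  let c := partial s in
  let new := [set i in pool s | j \in J i]%SET in
  SearchState
    (Component (seed c) (buyers c :|: new)%SET
       (items c :|: \bigcup_(i in new) J i)%SET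
       (rcons (trace c) (j, new)))
    (pool s :\: new)%SET
    (j |: checked s)%SET.

(* [search_loop] and [classify_from] relate to a start all results of runs with
   arbitrary picks of buyers and items. *)
Inductive search_loop (J : 'I_n -> {set item m}) :
    search_state -> search_state -> Prop :=
| search_stop s :
    ~~ (checked s \proper items (partial s)) -> search_loop J s s
| search_next s j s' :
    checked s \proper items (partial s) ->
    j \in (items (partial s) :\: checked s)%SET ->
    search_loop J (search_step J s j) s' -> search_loop J s s'.

Inductive classify_from (J : 'I_n -> {set item m}) :
    {set 'I_n} -> seq component -> Prop :=
| classify_stop : classify_from J finset.set0 [::]
| classify_next (Ic : {set 'I_n}) i s cs :
    i \in Ic -> search_loop J (search_init J Ic i) s ->
    classify_from J (pool s) cs -> classify_from J Ic (partial s :: cs).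

Definition classification (J : 'I_n -> {set item m}) : seq component -> Prop :=
  classify_from J [set: 'I_n]%SET.

(* Logarithms are only taken at pairs with j \in J i, where v_ij > 0. *)
Definition log_value (i : 'I_n) (j : item m) : R := ln (value0 i j).

(* One pass t of the loop on a. When an item lies in J i for several
   i \in new, the assignments are executed in an unspecified order and any of
   them may be the last one. *)
Definition assign (J : 'I_n -> {set item m}) (done : {set item m})
    (j : item m) (new : {set 'I_n}) (a a' : item m -> R) : Prop :=
  forall g, if g \in (\bigcup_(i in new) J i :\: done)%SET
            then exists i, [/\ i \in new, g \in J i &
                   a' g = a j + log_value i g - log_value i j]
            else a' g = a g.

Fixpoint assign_loop (J : 'I_n -> {set item m}) (done : {set item m})
    (tr : seq (item m * {set 'I_n})) (a a' : item m -> R) : Prop :=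
  if tr is (j, new) :: tr' then
    exists a1, assign J done j new a a1 /\
      assign_loop J (done :|: \bigcup_(i in new) J i)%SET tr' a1 a'
  else a' = a.

(* Entries outside J (seed c) are not set initially; the 0 is a placeholder,
   overwritten before it is read. *)
Definition assign_init (J : 'I_n -> {set item m}) (c : component)
    (j1 : item m) (j : item m) : R :=
  if j \in J (seed c) then log_value (seed c) j - log_value (seed c) j1 else 0.

Definition base_value (c : component) (a : item m -> R) : R :=
  if None \in items c then - a None
  else ln (\sum_(i in buyers c) budget M i) - ln (\sum_(j in items c) expR (a j)).

Definition component_solution (J : 'I_n -> {set item m}) (c : component)
    (mu : 'rV[R]_m) : Prop :=
  exists j1 new1 tr a,
    [/\ trace c = (j1, new1) :: tr,
        assign_loop J (J (seed c)) (trace c) (assign_init J c j1) a &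
        forall j, Some j \in items c -> mu 0 j = base_value c a + a (Some j)].

Definition solution (J : 'I_n -> {set item m}) (cs : seq component)
    (mu : 'rV[R]_m) : Prop :=
  List.Forall (fun c => component_solution J c mu) cs.

Definition near_items (mu : 'rV[R]_m) (r : R) (i : 'I_n) : {set item m} :=
  [set j | (h mu i - (2 * r)%:E <= log_ratio mu i j)%E]%SET.

(* A relation, because of the free picks; the output [None] is NaN. *)
Definition recovery (mu : 'rV[R]_m) (r : R) (out : option 'rV[R]_m) : Prop :=
  let J := near_items mu r in
  if [forall j : 'I_m, exists i, Some j \in J i] then
    exists cs mu', [/\ classification J cs, solution J cs mu' & out = Some mu']
  else out = None.

Definition stopping (out : option 'rV[R]_m) : Prop :=
  exists2 mu, out = Some mu & subdifferential F mu 0.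

(* Runs with input eps_k = theta ^ k. Iteration k >= 1 takes place only when no
   earlier iterate met the stopping criterion, so the later entries of [mus]
   and [outs] are unconstrained. The inner solver is known only through its
   guarantee. *)
Definition adaptive_apm_run (theta : R) (mustar : 'rV[R]_m)
    (mus : nat -> 'rV[R]_m) (outs : nat -> option 'rV[R]_m) : Prop :=
  forall k, (1 <= k)%N ->
    (forall k', (1 <= k' < k)%N -> ~ stopping (outs k')) ->
    [/\ in_box (mus k),
        (F (mus k) - F mustar <= (theta ^+ k)%:E)%E &
        recovery (mus k) (Num.sqrt (2 * theta ^+ k / sigma)) (outs k)].

(* Delta is positive, so the last case only concerns Delta = +oo. *)
Definition max_iterations (theta : R) (Delta : \bar R) : int :=
  if Delta is d%:E then
    Num.max (Num.ceil (2 * logb theta (Num.sqrt sigma * d / 6))) 1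
  else 1.

End Market.

(* Main.v *)
Require Import Defs.
From mathcomp Require Import all_boot all_order all_algebra.
From mathcomp Require Import boolp classical_sets constructive_ereal reals ereal sequences exp.
From mathcomp Require Import topology normedtype derive.
From mathcomp Require Import ring lra.

Import Order.TTheory GRing.Theory Num.Theory.
Import numFieldNormedType.Exports.
Local Open Scope ring_scope.

(** The vector [mustar] is itself the logarithm of an equilibrium price vector,
and the recovery step returns it exactly as soon as the inner solver is accurate
enough to reveal which items are optimal for each buyer at [mustar]. The accuracy
of iteration [K] suffices for that. An iteration that stops earlier has found a
minimizer as well, and every minimizer of [F] yields equilibrium prices.

Everything about [F] is read off from one first-order condition at a minimizer
[mu] ([first_order]): if the slope [t i] bounds the growth of [h i] in the
direction [d], that is, [- d_j <= t i] for every item [j] in the argmax set of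
buyer [i], then [\sum_k exp mu_k * d_k + \sum_i B_i * t_i >= 0]. Different
directions give the different ingredients.

- Towards another point [nu], with [t i] the increment of [h i], it combines
  with the strong convexity of [exp] into quadratic growth of [F] around its
  minimizer ([quadratic_growth]). Hence an [eps]-minimizer in the box is within
  [sqrt (2 * eps / sigma)] of [mustar] in every coordinate, which is the radius
  handed to the recovery oracle.
- Along plus or minus the indicator of a set [S] of goods it becomes two Hall
  inequalities comparing the value of [S] with the budgets of the buyers
  captive to [S] and of those interested in [S] ([captive_budget_le],
  [price_le_interested_budget]). They give the lower bound [p_lower] on prices,
  which places [mustar] in the region where [sigma] is a convexity modulus; they
  show that each good is optimal for some buyer; and on a connected component of
  the optimality graph they say that total price equals total budget.
- Over all directions at once, Farkas' lemma turns it into nonnegative spendings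
  on optimal items that exhaust all budgets and pay for all goods
  ([spending_exists]), which is a competitive equilibrium
  ([minimizer_ce_prices]).

If the radius [r] satisfies [4 * r < gap], the items within [2 * r] of the
maximum at the approximate solution are exactly the items optimal at [mustar]
([near_items_argmax]). The classification then splits the market into the
connected components of the optimality graph; within a component the ratios of
prices are forced by indifference of the buyers, and the scale is forced either
by the fixed price of the item 0 or by the budget balance, so the output can only
be [mustar] ([solution_minimizer]). Finally [theta ^ K <= sigma * gap ^ 2 / 36]
gives [4 * r <= 4 * sqrt 2 / 6 * gap < gap] ([radius_lt_gap]). *)

(** * Convexity, Farkas' lemma and finite extrema *)

(** Bartl's induction on the number of constraints. If the last constraint [k]
is not redundant, some [x0] violates the conclusion while satisfying the
others. Subtracting multiples of [k] makes every form vanish at [x0]; the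
remaining constraints then imply the conclusion on the kernel of [k], and the
signs at [x0] make the coefficient of [k] nonnegative. *)
Lemma farkas (R : realFieldType) (T I : finType) (s : seq I)
    (a : I -> T -> R) (g : T -> R) :
  uniq s ->
  (forall x : T -> R, (forall i, i \in s -> \sum_t a i t * x t <= 0) ->
    \sum_t g t * x t <= 0) ->
  exists2 lam : I -> R, (forall i, 0 <= lam i) &
    forall t, g t = \sum_(i <- s) lam i * a i t.
Proof.
elim: s a g => [|k s IH] a g /=.
  (* With no constraint, [g] is tested against itself. *)
  move=> _ gle; exists (fun=> 0) => // t; rewrite big_nil.
  have: \sum_u g u * g u <= 0 by apply: gle.
  rewrite le_eqVlt ltNge sumr_ge0 ?orbF; last by move=> u _; exact: sqr_ge0.
  rewrite psumr_eq0; last by move=> u _; exact: sqr_ge0.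
  by move=> /allP/(_ t (mem_index_enum _)); rewrite mulf_eq0 orbb => /eqP.
case/andP=> ks us gle.
have [imp|] := pselect (forall x : T -> R,
    (forall i, i \in s -> \sum_t a i t * x t <= 0) -> \sum_t g t * x t <= 0).
  have [lam lam0 glam] := IH a g us imp.
  exists (fun i => if i == k then 0 else lam i) => [i|t]; first by case: eqP.
  rewrite big_cons eqxx mul0r add0r glam; apply: eq_big_seq => i si.
  by case: eqP => // ik; rewrite -ik si in ks.
move=> /existsNP[x0 /not_implyP[x0le /negP]]; rewrite -ltNge => gx0.
have ax0 : 0 < \sum_t a k t * x0 t.
  rewrite ltNge; apply/negP => le0; move: gx0; rewrite ltNge => /negP; apply.
  by apply: gle => i; rewrite inE => /predU1P[->|/x0le].
pose w i := (\sum_t a i t * x0 t) / (\sum_t a k t * x0 t).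
pose wg := (\sum_t g t * x0 t) / (\sum_t a k t * x0 t).
(* Project along x0 onto the kernel of the constraint k. *)
pose proj (x : T -> R) t :=
  x t - (\sum_t a k t * x t) / (\sum_t a k t * x0 t) * x0 t.
have projE (b : T -> R) (x : T -> R) : \sum_t b t * proj x t =
    \sum_t (b t - (\sum_t b t * x0 t) / (\sum_t a k t * x0 t) * a k t) * x t.
  rewrite /proj; under eq_bigr => t _ do rewrite mulrBr mulrCA.
  under [RHS]eq_bigr => t _ do rewrite mulrBl -[X in _ - X]mulrA.
  rewrite !sumrB -!mulr_sumr; congr (_ - _);
  by rewrite [LHS]mulrC [LHS]mulrCA [LHS]mulrC.
have [|lam lam0 glam] :=
    IH (fun i t => a i t - w i * a k t) (fun t => g t - wg * a k t) us.
  move=> x xle; rewrite -projE; apply: gle => i; rewrite inE.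
  case/predU1P => [->|si]; last by rewrite projE; exact: xle.
  rewrite projE divff ?gt_eqF // big1 // => t _.
  by rewrite mul1r subrr mul0r.
exists (fun i => if i == k then wg - \sum_(j <- s) lam j * w j else lam i).
  move=> i; case: eqP => // _; rewrite subr_ge0 big_seq.
  apply: (@le_trans _ _ 0); last by rewrite divr_ge0 // ltW.
  apply: sumr_le0 => j sj; rewrite mulr_ge0_le0 //.
  by rewrite mulr_le0_ge0 ?x0le // invr_ge0 ltW.
move=> t; rewrite big_cons eqxx.
rewrite [X in _ + X](eq_big_seq (fun i => lam i * a i t)); last first.
  by move=> i si; case: eqP => // ik; rewrite -ik si in ks.
have /= := glam t; under eq_bigr => i _ do rewrite mulrBr mulrA.
rewrite sumrB -mulr_suml => /eqP; rewrite subr_eq => /eqP ->; ring.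
Qed.

(** The derivative in [b] of the difference has the sign of [b - a], since
[exp] has slope at least [c] between [a] and [b]. *)
Lemma expR_strongly_convex (R : realType) (c a b : R) :
  c <= expR a -> c <= expR b ->
  expR a + expR a * (b - a) + c / 2 * (b - a) ^+ 2 <= expR b.
Proof.
move=> ca cb.
pose f x := expR x - expR a * x - c / 2 * (x - a) ^+ 2.
pose df x := expR x - expR a - c * (x - a).
have dfP (x : R) : is_derive x 1 f (df x).
  rewrite /f /df; apply: is_derive_eq.
  by cbn; field.
have fc : continuous f.
  move=> x; apply: differentiable_continuous; apply/derivable1_diffP.
  by have [] := dfP x.
have tan (x y : R) : expR x + expR x * (y - x) <= expR y.
  have := expR_ge1Dx (y - x); rewrite -(ler_pM2l (expR_gt0 x)) mulrDr mulr1.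
  by rewrite -expRD addrCA subrr addr0.
suff : 0 <= f b - f a by rewrite /f; nra.
have [ab|/ltW ba] := leP a b.
  have [|z /itvP zab ->] := MVT_segment ab (fun x _ => dfP x).
    exact: continuous_subspaceT.
  rewrite mulr_ge0 ?subr_ge0 // /df.
  have := tan a z; have az : a <= z by rewrite zab.
  by nra.
have [|z /itvP zab fab] := MVT_segment ba (fun x _ => dfP x).
  exact: continuous_subspaceT.
rewrite -opprB fab -mulrN opprB.
have za : z <= a by rewrite zab.
have bz : b <= z by rewrite zab.
have cz : c <= expR z by rewrite (le_trans cb) // ler_expR.
by rewrite mulr_le0 ?subr_le0 // /df; have := tan z a; nra.
Qed.

(** The inverse of the bound [exp (- x) >= 1 - x]; it replaces the derivative
of [exp] by an estimate with explicit error. *)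
Lemma expR_le1Dx_sqr (R : realType) (x : R) :
  x <= 1 / 2 -> expR x <= 1 + x + 2 * x ^+ 2.
Proof.
move=> x2; rewrite -[x]opprK expRN invf_ple ?posrE ?expR_gt0 //; last by nra.
apply: le_trans (expR_ge1Dx _); rewrite opprK.
by rewrite -[_^-1]mul1r ler_pdivrMr; nra.
Qed.

Lemma small_forall (R : realFieldType) (I : finType) (P : I -> R -> Prop) :
  (forall i, exists2 e, 0 < e & forall s, 0 < s <= e -> P i s) ->
  exists2 e, 0 < e & forall s, 0 < s <= e -> forall i, P i s.
Proof.
move=> /fin_all_exists2[e e0 Pe]; exists (\big[Num.min/1]_i e i).
  by apply: lt_bigmin.
move=> s /andP[s0 se] i; apply: Pe; rewrite s0 (le_trans se) //.
exact: bigmin_le.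
Qed.

Lemma rmaxP (R : realType) (I : finType) (f : I -> R) : I ->
  exists i, rmax f = f i /\ forall j, f j <= f i.
Proof.
move=> i0; have [i _ fi] :
    {i | i \in predT & \big[maxe/-oo%E]_i (f i)%:E = (f i)%:E}.
  by apply: (eq_bigmax i0) => // i _; exact: leNye.
exists i; split=> [|j]; first by rewrite /rmax fi.
by rewrite -lee_fin -fi; exact: (@le_bigmax _ _ _ _ (EFin \o f)).
Qed.

Lemma rminP (R : realType) (I : finType) (f : I -> R) : I ->
  exists i, rmin f = f i /\ forall j, f i <= f j.
Proof.
move=> i0; have [i _ fi] :
    {i | i \in predT & \big[mine/+oo%E]_i (f i)%:E = (f i)%:E}.
  by apply: (eq_bigmin i0) => // i _; exact: leey.
exists i; split=> [|j]; first by rewrite /rmin fi.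
by rewrite -lee_fin -fi; exact: (@bigmin_le _ _ _ _ _ (EFin \o f)).
Qed.

Lemma sum_item (V : nmodType) (m : nat) (f : item m -> V) :
  \sum_j f j = f None + \sum_k f (Some k).
Proof.
rewrite (bigD1 None) //=; congr (_ + _).
rewrite (reindex_omap Some id) /=; last by case.
by apply: eq_bigl => k; rewrite eqxx.
Qed.

(** * The objective and its first-order condition *)

Section Objective.
Context {R : realType} {m n : nat} (M : fisher_market R m n).
Implicit Types (mu d : 'rV[R]_m) (i : 'I_n) (j : item m).

(** The pairs at which [log_ratio] is not [-oo]. For the item 0 this says that
the market is quasi-linear, and then its log price is 0. *)
Definition desirable i j : bool :=
  if j is Some k then 0 < value M i k else alpha M == 1%E.

Definition log_price mu j : R := if j is Some k then mu 0 k else 0.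

(** The logarithm of the bang per buck [v_ij / p_j]. *)
Definition log_bang mu i j : R := log_value M i j - log_price mu j.

Definition max_log_bang mu i : R := fine (h M mu i).

Definition objective mu : R :=
  \sum_k expR (mu 0 k) + \sum_i budget M i * max_log_bang mu i.

Lemma log_ratioE mu i j :
  log_ratio M mu i j = if desirable i j then (log_bang mu i j)%:E else -oo%E.
Proof.
rewrite /log_ratio /log_bang /log_value; case: j => [k|] /=.
  have := value_ge0 M i k; rewrite le_eqVlt => /predU1P[<-|v0].
    by rewrite lexx ltxx.
  by rewrite leNgt v0.
rewrite ler10 ln1; case: (alpha_cases M) => ->; rewrite /= ?eqxx //.
by rewrite ler10 ln1.
Qed.

Lemma desirable_good i : exists k, desirable i (Some k).
Proof.
by have [k vk] := value_row_neq0 M i; exists k; rewrite /= lt0r vk value_ge0.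
Qed.

Lemma hE mu i : h M mu i = (max_log_bang mu i)%:E.
Proof.
rewrite /max_log_bang fineK // fin_numE; apply/andP; split.
  have [k dk] := desirable_good i; rewrite -ltNye.
  apply: lt_le_trans (le_bigmax _ _ (Some k)).
  by rewrite log_ratioE dk ltNyr.
rewrite -ltey; apply: bigmax_lt => // j _; rewrite log_ratioE.
by case: ifP; rewrite ?ltry.
Qed.

Lemma FE mu : F M mu = (objective mu)%:E.
Proof.
rewrite /F /objective EFinD !sumEFin; congr (_ + _)%E.
by rewrite -sumEFin; apply: eq_bigr => i _; rewrite hE EFinM.
Qed.

Lemma le_max_log_bang mu i j :
  desirable i j -> log_bang mu i j <= max_log_bang mu i.
Proof.
move=> dj; rewrite -lee_fin -hE; apply: le_trans (le_bigmax _ _ j).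
by rewrite log_ratioE dj.
Qed.

Lemma max_log_bang_le mu i (c : R) :
  (forall j, desirable i j -> log_bang mu i j <= c) -> max_log_bang mu i <= c.
Proof.
move=> dc; rewrite -lee_fin -hE; apply: bigmax_le => [|j _]; first exact: leNye.
by rewrite log_ratioE; case: ifP => [/dc|_]; rewrite ?lee_fin ?leNye.
Qed.

Lemma mem_argmax mu i j :
  (j \in argmax_items M mu i) =
  desirable i j && (log_bang mu i j == max_log_bang mu i).
Proof. by rewrite inE log_ratioE hE; case: ifP. Qed.

Lemma argmaxP {mu i j} : j \in argmax_items M mu i ->
  desirable i j /\ log_bang mu i j = max_log_bang mu i.
Proof. by rewrite mem_argmax => /andP[? /eqP]. Qed.

Lemma argmax_neq0 mu i : exists j, j \in argmax_items M mu i.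
Proof.
have [k dk] := desirable_good i.
have [j _ hj] : {j | true & h M mu i = log_ratio M mu i j}.
  by apply: (eq_bigmax (Some k)) => // j _; exact: leNye.
by exists j; rewrite inE hj.
Qed.

Lemma max_log_bang_gt mu i j :
  desirable i j -> j \notin argmax_items M mu i ->
  log_bang mu i j < max_log_bang mu i.
Proof.
by move=> dj; rewrite mem_argmax dj /= lt_neqAle le_max_log_bang // andbT.
Qed.

Lemma minimizer_objective mu nu :
  is_minimizer (F M) mu -> objective mu <= objective nu.
Proof. by move=> /(_ nu); rewrite !FE lee_fin. Qed.

Lemma log_bang_shift mu d (s : R) i j :
  log_bang (mu + s *: d) i j = log_bang mu i j - s * log_price d j.
Proof. by rewrite /log_bang /log_price; case: j => [k|]; rewrite ?mxE; ring. Qed.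

(** Optimal items keep the increment below [s * t i] by hypothesis; the others
start strictly below the maximum, and there are finitely many of them. *)
Lemma max_log_bang_shift mu d (t : 'I_n -> R) :
  (forall i j, j \in argmax_items M mu i -> - log_price d j <= t i) ->
  exists2 e, 0 < e & forall s, 0 < s <= e ->
    forall i, max_log_bang (mu + s *: d) i <= max_log_bang mu i + s * t i.
Proof.
move=> dt; have [|e e0 eP] := small_forall R ('I_n * item m)%type (fun ij s =>
    desirable ij.1 ij.2 -> log_bang (mu + s *: d) ij.1 ij.2 <=
      max_log_bang mu ij.1 + s * t ij.1).
  case=> i j /=; have [ji|ji] := boolP (j \in argmax_items M mu i).
    exists 1 => // s /andP[s0 _] dj; rewrite log_bang_shift.
    by have := dt i j ji; have := le_max_log_bang mu i j dj; nra.
  have [dj|_] := boolP (desirable i j); last by exists 1.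
  have := max_log_bang_gt mu i j dj ji; rewrite -subr_gt0.
  set g := _ - _ => g0; set c := 1 + `|log_price d j + t i|.
  have c0 : 0 < c by rewrite ltr_pwDl.
  exists (g / c); first exact: divr_gt0.
  move=> s /andP[s0]; rewrite ler_pdivlMr // /c => sg _.
  rewrite log_bang_shift; move: sg; rewrite /g.
  have := ler_norm (- (log_price d j + t i)); rewrite normrN.
  by nra.
exists e => // s se i; apply: max_log_bang_le => j dj; exact: (eP s se (i, j)).
Qed.

(** Along [mu + s *: d], for small positive [s], the objective grows by at
most [s] times the right-hand side plus a term of order [s ^+ 2]. *)
Lemma first_order mu d (t : 'I_n -> R) :
  is_minimizer (F M) mu ->
  (forall i j, j \in argmax_items M mu i -> - log_price d j <= t i) ->
  0 <= \sum_k expR (mu 0 k) * d 0 k + \sum_i budget M i * t i.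
Proof.
move=> mumin /max_log_bang_shift[e e0 eP]; set G := _ + _.
have [|e' e'0 e'P] := small_forall R 'I_m (fun k s => s * d 0 k <= 1 / 2).
  move=> k; exists (1 / 2 / (1 + `|d 0 k|)).
    by rewrite !divr_gt0 // ltr_pwDl.
  move=> s /andP[s0]; rewrite ler_pdivlMr ?ltr_pwDl //.
  by have := ler_norm (d 0 k); nra.
pose D := \sum_k expR (mu 0 k) * (2 * d 0 k ^+ 2).
have D0 : 0 <= D.
  by apply: sumr_ge0 => k _; rewrite mulr_ge0 ?expR_ge0 // mulr_ge0 ?sqr_ge0.
have GD s : 0 < s -> s <= e -> s <= e' -> 0 <= G + s * D.
  move=> s0 se se'; rewrite -(pmulr_rge0 _ s0).
  have := minimizer_objective mu (mu + s *: d) mumin.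
  rewrite -subr_ge0 => /le_trans; apply; rewrite /objective /G /D.
  rewrite opprD addrACA -!sumrB !mulrDr addrAC !mulr_sumr -big_split /=.
  apply: lerD; apply: ler_sum => k _; last first.
    have := eP s; rewrite s0 se => /(_ isT k); have := budget_gt0 M k; nra.
  rewrite !mxE expRD.
  have := expR_le1Dx_sqr _ (s * d 0 k); have := e'P s; rewrite s0 se'.
  move=> /(_ isT k) sd /(_ sd); have := expR_gt0 (mu 0 k); nra.
rewrite leNgt; apply/negP => G0.
(* Small enough for [s * D] to stay below [- G]. *)
pose s := Num.min e (Num.min e' (- G / (2 * (D + 1)))).
have q0 : 0 < - G / (2 * (D + 1)).
  by rewrite divr_gt0 ?oppr_gt0 // mulr_gt0 // ltr_wpDl.
have s0 : 0 < s by rewrite !lt_min e0 e'0.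
have sD : s <= - G / (2 * (D + 1)) by rewrite !ge_min lexx !orbT.
have := GD s s0; rewrite !ge_min !lexx ?orbT => /(_ isT isT).
move: sD; rewrite ler_pdivlMr; last by rewrite mulr_gt0 // ltr_wpDl.
by nra.
Qed.
End Objective.

(** * Growth, price bounds and equilibrium at a minimizer *)

Section Minimizer.
Context {R : realType} {m n : nat} (M : fisher_market R m n).
Implicit Types (mu nu : 'rV[R]_m) (i : 'I_n) (j : item m) (S : {set item m}).

Let ind S : 'rV[R]_m := \row_k (Some k \in S)%:R.

Lemma sum_ind mu S (c : R) : None \notin S ->
  \sum_k expR (mu 0 k) * (c *: ind S) 0 k =
  c * \sum_(j in S) expR (log_price mu j).
Proof.
move=> /negPf NS; rewrite [in RHS]big_mkcond sum_item NS add0r mulr_sumr.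
by apply: eq_bigr => k _; rewrite !mxE mulrCA; case: ifP; rewrite ?mulr1 ?mulr0.
Qed.

Lemma log_price_ind (c : R) S j : None \notin S ->
  log_price (c *: ind S) j = c * (j \in S)%:R.
Proof. by case: j => [k|] /= /negPf NS; rewrite ?mxE // NS mulr0. Qed.

(** Raise all log prices in [S] at unit rate: the buyers whose optimal items
all lie in [S] lose bang per buck at that rate, and nobody gains. *)
Lemma captive_budget_le mu S : is_minimizer (F M) mu -> None \notin S ->
  \sum_(i | argmax_items M mu i \subset S) budget M i <=
  \sum_(j in S) expR (log_price mu j).
Proof.
move=> mumin NS; pose t i : R := - (argmax_items M mu i \subset S)%:R.
have := first_order M mu (1 *: ind S) t mumin; rewrite sum_ind // mul1r.
rewrite [X in _ + X](_ : _ =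
    - \sum_(i | argmax_items M mu i \subset S) budget M i).
  rewrite subr_ge0; apply=> i j ji; rewrite log_price_ind // mul1r lerN2 ler_nat.
  by case: (boolP (_ \subset S)) => // /fintype.subsetP/(_ j ji) ->.
rewrite [in RHS]big_mkcond -sumrN; apply: eq_bigr => i _; rewrite /t.
by case: ifP; rewrite ?mulrN ?mulr1 ?mulr0 ?oppr0.
Qed.

(** Lower all log prices in [S] at unit rate: only the buyers with an optimal
item in [S] gain bang per buck. *)
Lemma price_le_interested_budget mu S : is_minimizer (F M) mu -> None \notin S ->
  \sum_(j in S) expR (log_price mu j) <=
  \sum_(i | ~~ [disjoint argmax_items M mu i & S]) budget M i.
Proof.
move=> mumin NS; pose t i : R := (~~ [disjoint argmax_items M mu i & S])%:R.
have := first_order M mu (-1 *: ind S) t mumin; rewrite sum_ind // mulN1r.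
rewrite [X in _ + X](_ : _ =
    \sum_(i | ~~ [disjoint argmax_items M mu i & S]) budget M i).
  rewrite addrC subr_ge0; apply=> i j ji.
  rewrite log_price_ind // mulN1r opprK ler_nat.
  case: (boolP (j \in S)) => // jS; rewrite /t lt0b.
  by apply/pred0Pn; exists j; rewrite /= ji.
rewrite [in RHS]big_mkcond; apply: eq_bigr => i _; rewrite /t.
by case: ifP; rewrite ?mulrN ?mulr1 ?mulr0 ?oppr0.
Qed.

(** Otherwise the price of the good would be bounded by an empty sum of
budgets. *)
Lemma minimizer_covers mu k : is_minimizer (F M) mu ->
  exists i, Some k \in argmax_items M mu i.
Proof.
move=> mumin; apply: contrapT => /forallNP nok.
have := price_le_interested_budget mu [set Some k] mumin.
rewrite inE big_set1 big_pred0 => [/(_ isT)|i].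
  by rewrite leNgt expR_gt0.
by apply/negbF; rewrite disjoint_sym disjoints1; apply/negP/nok.
Qed.

(** The buyers captive to [S] and those interested in [S] are both [I], so the
two Hall inequalities become an equality. *)
Lemma component_budget mu S (I : {set 'I_n}) :
  is_minimizer (F M) mu -> None \notin S ->
  (forall i, i \in I -> argmax_items M mu i \subset S) ->
  (forall i, i \notin I -> [disjoint argmax_items M mu i & S]) ->
  \sum_(j in S) expR (log_price mu j) = \sum_(i in I) budget M i.
Proof.
move=> mumin NS sub dis.
have [fit other] : (forall i, (argmax_items M mu i \subset S) = (i \in I)) /\
    (forall i, ~~ [disjoint argmax_items M mu i & S] = (i \in I)).
  suff H i : (argmax_items M mu i \subset S) = (i \in I) /\
      ~~ [disjoint argmax_items M mu i & S] = (i \in I).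
    by split=> i; have [] := H i.
  have [j ji] := argmax_neq0 M mu i.
  have [iI|iI] := boolP (i \in I).
    rewrite (sub i iI); split=> //; apply/pred0Pn; exists j => /=.
    by rewrite ji (fintype.subsetP (sub i iI)).
  rewrite (dis i iI); split=> //; apply/negP => /fintype.subsetP/(_ j ji) jS.
  by have /pred0P/(_ j) := dis i iI; rewrite /= ji jS.
apply/le_anti/andP; split.
  apply: le_trans (price_le_interested_budget mu S mumin NS) _.
  by rewrite (eq_bigl _ _ other).
by apply: le_trans (captive_budget_le mu S mumin NS); rewrite (eq_bigl _ _ fit).
Qed.

(** The first-order condition in the direction [nu - mu] absorbs the linear
part of the strong convexity bound. *)
Lemma quadratic_growth mu nu (c : R) : is_minimizer (F M) mu ->
  (forall k, c <= expR (mu 0 k)) -> (forall k, c <= expR (nu 0 k)) ->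
  c / 2 * \sum_k (nu 0 k - mu 0 k) ^+ 2 <= objective M nu - objective M mu.
Proof.
move=> mumin cmu cnu.
have := first_order M mu (nu - mu)
  (fun i => max_log_bang M nu i - max_log_bang M mu i) mumin.
have dt i j : j \in argmax_items M mu i ->
    - log_price (nu - mu) j <= max_log_bang M nu i - max_log_bang M mu i.
  case/argmaxP=> dj <-; have := le_max_log_bang M nu i j dj.
  by rewrite /log_bang /log_price; case: j dj => [k|] _; rewrite ?mxE; lra.
move=> /(_ dt) fo; rewrite -subr_ge0; apply: le_trans fo _.
rewrite /objective opprD addrACA -!sumrB mulr_sumr addrAC -sumrB.
apply: lerD; apply: ler_sum => k _; last by rewrite -mulrBr.
rewrite !mxE; have := expR_strongly_convex R c (mu 0 k) (nu 0 k) (cmu k) (cnu k).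
lra.
Qed.

Lemma alphaVE : alphaV M = (alpha M == 1%E)%:R.
Proof.
rewrite /alphaV; case: (alpha_cases M) => ->; rewrite ?eqxx ?inve1 //.
Qed.

Lemma alphaV_ge0 : 0 <= alphaV M.
Proof. by rewrite alphaVE ler0n. Qed.

(** Either the item 0 is optimal for the buyer and caps its bang per buck at
1, or the goods optimal for the buyer cost at least its budget, while each of
them costs [v_ik] divided by the bang per buck. *)
Lemma expR_max_log_bang_le mu i : is_minimizer (F M) mu ->
  budget M i * expR (max_log_bang M mu i) <=
  \sum_k `|value M i k| + alphaV M * budget M i.
Proof.
move=> mumin; have B0 := budget_gt0 M i.
have [Ni|Ni] := boolP (None \in argmax_items M mu i).
  have [/= a1 <-] := argmaxP M Ni.
  rewrite /log_bang /log_value /= ln1 subr0 expR0 mulr1 alphaVE a1 mul1r.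
  by rewrite lerDr sumr_ge0.
apply: ler_wpDr; first by rewrite mulr_ge0 ?alphaV_ge0 // ltW.
have : budget M i <= \sum_(j in argmax_items M mu i) expR (log_price mu j).
  apply: le_trans (captive_budget_le mu _ mumin Ni).
  by rewrite (bigD1 i) //= lerDl sumr_ge0 // => l _; rewrite ltW ?budget_gt0.
move=> Ble; apply: (le_trans (ler_wpM2r (expR_ge0 _) Ble)).
rewrite big_mkcond sum_item (negPf Ni) add0r mulr_suml.
apply: ler_sum => k _; case: ifP => [/argmaxP[/= dk <-]|_]; last by rewrite mul0r.
by rewrite -expRD /log_bang /= addrC subrK lnK ?posrE // ler_norm.
Qed.

Lemma price_lower_bound mu i k : is_minimizer (F M) mu ->
  value M i k * budget M i /
    (\sum_l `|value M i l| + alphaV M * budget M i) <= expR (mu 0 k).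
Proof.
move=> mumin; have B0 := budget_gt0 M i.
have H := expR_max_log_bang_le mu i mumin.
have S0 : 0 < \sum_l `|value M i l| + alphaV M * budget M i.
  by apply: lt_le_trans H; rewrite mulr_gt0 ?expR_gt0.
rewrite ler_pdivrMr //; apply: le_trans (ler_wpM2l (expR_ge0 _) H).
rewrite mulrCA [leLHS]mulrC ler_pM2l // -expRD.
have := value_ge0 M i k; rewrite le_eqVlt => /predU1P[<-|v0]; first exact: expR_ge0.
rewrite -(lnK v0) ler_expR addrC -lerBlDr.
exact: (le_max_log_bang M mu i (Some k)).
Qed.

Lemma p_lowerP mu : (1 <= m)%N -> (1 <= n)%N -> is_minimizer (F M) mu ->
  0 < p_lower M /\ forall k, p_lower M <= expR (mu 0 k).
Proof.
move=> m1 n1 mumin; have k0 : 'I_m := Ordinal m1; have i0 : 'I_n := Ordinal n1.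
pose q (k : 'I_m) i := value M i k * budget M i /
  (\sum_l `|value M i l| + alphaV M * budget M i).
have [k [pE pmin]] := rminP R _ (fun k => rmax (q k)) k0.
rewrite /p_lower -/q pE; split=> [|l].
  have [i vi] := value_col_neq0 M k.
  have [i' [-> /(_ i) qmax]] := rmaxP R _ (q k) i0; apply: lt_le_trans qmax.
  have vp : 0 < value M i k by rewrite lt0r vi value_ge0.
  rewrite divr_gt0 ?mulr_gt0 ?budget_gt0 // ltr_wpDr //.
    by rewrite mulr_ge0 ?alphaV_ge0 // ltW ?budget_gt0.
  by rewrite (bigD1 k) //= ltr_wpDr ?sumr_ge0 // normr_gt0.
apply: le_trans (pmin l) _; have [i [-> _]] := rmaxP R _ (q l) i0.
exact: price_lower_bound.
Qed.

(** The first-order condition says that the inequalities [- d_j - t_i <= 0],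
one for each optimal pair, imply [- (\sum_k exp mu_k * d_k + \sum_i B_i * t_i)
<= 0]. The Farkas multipliers of the pairs are the amounts spent. *)
Lemma spending_exists mu : is_minimizer (F M) mu ->
  exists b : 'I_n -> item m -> R,
  [/\ forall i j, 0 <= b i j,
      forall i j, j \notin argmax_items M mu i -> b i j = 0,
      forall i, \sum_j b i j = budget M i &
      forall k, \sum_i b i (Some k) = expR (mu 0 k)].
Proof.
move=> mumin.
pose a (ij : 'I_n * item m) (t : 'I_m + 'I_n) : R :=
  match t with inl k => - (ij.2 == Some k)%:R | inr i => - (ij.1 == i)%:R end.
pose g (t : 'I_m + 'I_n) : R :=
  match t with inl k => - expR (mu 0 k) | inr i => - budget M i end.
pose E := [pred ij : 'I_n * item m | ij.2 \in argmax_items M mu ij.1].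
have [|x xle|lam lam0 glam] := farkas R _ _ (enum E) a g.
- exact: enum_uniq.
- have := first_order M mu (\row_k x (inl k)) (fun i => x (inr i)) mumin.
  have dt i j : j \in argmax_items M mu i ->
      - log_price (\row_k x (inl k)) j <= x (inr i).
    move=> ji; have := xle (i, j); rewrite mem_enum inE /= => /(_ ji).
    rewrite big_sumType /= (bigD1 i) //= eqxx [X in _ + (_ + X)]big1; last first.
      by move=> i' /negPf ii'; rewrite eq_sym ii' oppr0 mul0r.
    rewrite mulN1r addr0.
    suff -> : \sum_(k < m) - (j == Some k)%:R * x (inl k) =
        - log_price (\row_k x (inl k)) j by lra.
    case: (j) => [k|] /=; last first.
      rewrite oppr0 big1 // => k _.
      by rewrite mul0r.
    rewrite (bigD1 k) //= eqxx big1 ?mxE ?addr0 ?mulN1r // => k' /negPf kk'.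
    by rewrite (inj_eq Some_inj) eq_sym kk' oppr0 mul0r.
  move=> /(_ dt); rewrite -oppr_le0; apply: le_trans.
  rewrite big_sumType /= opprD -!sumrN; apply: lerD; apply: ler_sum => k _.
    by rewrite mxE mulNr.
  by rewrite mulNr.
have sumE (f : 'I_n * item m -> R) : \sum_(ij <- enum E) f ij =
    \sum_i \sum_j if j \in argmax_items M mu i then f (i, j) else 0.
  rewrite big_enum /= big_mkcond pair_bigA /=.
  by apply: eq_bigr => -[i j] _.
exists (fun i j => if j \in argmax_items M mu i then lam (i, j) else 0); split.
- by move=> i j; case: ifP.
- by move=> i j /negPf ->.
- move=> i; have := glam (inr i); rewrite /g sumE /= => /(congr1 -%R).
  rewrite opprK => ->; rewrite (bigD1 i) //= [X in _ + X]big1 ?addr0.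
    rewrite -sumrN; apply: eq_bigr => j _.
    by case: ifP; rewrite ?eqxx ?mulrN ?mulr1 ?opprK ?oppr0.
  move=> i' /negPf ii'; apply: big1 => j _.
  by rewrite ii' oppr0 mulr0; case: ifP.
- move=> k; have := glam (inl k); rewrite /g sumE /= => /(congr1 -%R).
  rewrite opprK => ->; rewrite -sumrN; apply: eq_bigr => i _.
  rewrite (bigD1 (Some k)) //= eqxx big1 ?addr0.
    by case: ifP; rewrite ?mulrN ?mulr1 ?opprK ?oppr0.
  by move=> j /negPf jk; rewrite jk oppr0 mulr0; case: ifP.
Qed.

(** The two kinds of utility at once: [alphaV] is 1 or 0. *)
Lemma utilityE p i (y : 'rV[R]_m) :
  utility M p i y = \sum_k (value M i k - alphaV M * p 0 k) * y 0 k.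
Proof.
rewrite /utility alphaVE; case: (alpha_cases M) => -> /=.
  by apply: eq_bigr => k _; rewrite eqxx mul1r.
by apply: eq_bigr => k _; rewrite mul0r subr0.
Qed.

(** With [H] the bang per buck of a buyer, every unit of money spent on a good
yields utility at most [H - alphaV], with equality on optimal goods. Money is
left over only when the item 0 is optimal, and then [H = alphaV]. *)
Lemma minimizer_ce_prices mu : is_minimizer (F M) mu ->
  ce_prices M (map_mx expR mu).
Proof.
move=> mumin; have [b [b0 bJ bi bk]] := spending_exists mu mumin.
have p0 k : 0 < expR (mu 0 k) := expR_gt0 _.
have spent i : \sum_k b i (Some k) = budget M i - b i None.
  by rewrite -bi sum_item addrAC subrr add0r.
exists (\matrix_(i, k) (b i (Some k) / expR (mu 0 k))).
have px i k : expR (mu 0 k) * (b i (Some k) / expR (mu 0 k)) = b i (Some k).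
  by rewrite mulrC divfK // gt_eqF.
split.
- split=> [j|i j]; rewrite !mxE ?expR_ge0 // divr_ge0 ?expR_ge0 //.
- move=> i; rewrite /affordable; under eq_bigr => k _ do rewrite !mxE px.
  by rewrite spent gerBl.
- move=> i y y0 ya; rewrite !utilityE.
  set H := expR (max_log_bang M mu i).
  have vH k : value M i k <= H * expR (mu 0 k).
    have := value_ge0 M i k; rewrite le_eqVlt => /predU1P[<-|v0].
      by rewrite mulr_ge0 ?expR_ge0.
    rewrite /H -expRD -(lnK v0) ler_expR -lerBlDr.
    exact: (le_max_log_bang M mu i (Some k)).
  have aH : alphaV M <= H.
    rewrite alphaVE; case: eqP => [a1|_]; last exact: expR_ge0.
    rewrite -[leLHS]expR0 ler_expR.
    have := le_max_log_bang M mu i None; rewrite /= a1 eqxx => /(_ isT).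
    by rewrite /log_bang /log_value /= ln1 subr0.
  have NH : (H - alphaV M) * b i None = 0.
    have [/argmaxP[/= a1]|/bJ ->] := boolP (None \in argmax_items M mu i);
      last by rewrite mulr0.
    rewrite /log_bang /log_value /= ln1 subr0 /H => <-.
    by rewrite alphaVE a1 expR0 subrr mul0r.
  have -> : \sum_k (value M i k - alphaV M * map_mx expR mu 0 k) *
       row i (\matrix_(i, k) (b i (Some k) / expR (mu 0 k))) 0 k =
      (H - alphaV M) * budget M i.
    transitivity (\sum_k (H - alphaV M) * b i (Some k)); last first.
      by rewrite -mulr_sumr spent mulrBr NH subr0.
    apply: eq_bigr => k _; rewrite !mxE.
    have [/argmaxP[/= v0]|/bJ ->] := boolP (Some k \in argmax_items M mu i);
      last by rewrite mul0r !mulr0.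
    rewrite /H => <-; rewrite /log_bang expRB lnK //.
    rewrite -[in RHS](px i k) [in RHS]mulrA.
    by congr (_ * _); rewrite mulrBl divfK // gt_eqF ?expR_gt0.
  apply: (@le_trans _ _ ((H - alphaV M) * \sum_k expR (mu 0 k) * y 0 k)).
    rewrite mulr_sumr; apply: ler_sum => k _; rewrite mulrA ler_wpM2r //.
    by rewrite mxE mulrBl lerD2r.
  apply: ler_wpM2l; first by rewrite subr_ge0.
  by move: ya; rewrite /affordable; under eq_bigr => k _ do rewrite mxE.
- move=> k.
  have -> : \sum_i (\matrix_(i, k) (b i (Some k) / expR (mu 0 k))) i k = 1.
    under eq_bigr => i _ do rewrite mxE.
    by rewrite -mulr_suml bk divff // gt_eqF.
  by [].
Qed.
End Minimizer.

(** * Components found by the classification procedure *)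

Section Classification.
Context {m n : nat} (J : 'I_n -> {set item m}).
Implicit Types (c : component m n) (D : {set item m})
  (tr : seq (item m * {set 'I_n})).

(** The items known after a trace that starts from the items [D]. *)
Definition reached D tr : {set item m} :=
  foldl (fun (D : {set item m}) (p : item m * {set 'I_n}) =>
    D :|: \bigcup_(i in p.2) J i) D tr.

(** Each pass reads the value of an item that is already known and that every
buyer it brings in shares: what the propagation of log price ratios needs. *)
Fixpoint grounded D tr : Prop :=
  if tr is (j, new) :: tr' then
    [/\ j \in D, forall i, i \in new -> j \in J i &
        grounded (D :|: \bigcup_(i in new) J i) tr']
  else True.

Lemma grounded_rcons D tr j (new : {set 'I_n}) :
  grounded D tr -> j \in reached D tr ->
  (forall i, i \in new -> j \in J i) -> grounded D (rcons tr (j, new)).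
Proof.
elim: tr D => [|[k nw] tr IH] D /=; first by split.
by case=> kD kn gr jr newj; split=> //; exact: IH.
Qed.

Lemma reached_rcons D tr p :
  reached D (rcons tr p) = reached D tr :|: \bigcup_(i in p.2) J i.
Proof. by rewrite /reached foldl_rcons. Qed.

Lemma reached_sub D tr : D \subset reached D tr.
Proof.
elim: tr D => [|p tr IH] D //=.
exact: fintype.subset_trans (finset.subsetUl _ _) (IH _).
Qed.

Record well_built c : Prop := WellBuilt {
  built_items : items c = reached (J (seed c)) (trace c);
  built_grounded : grounded (J (seed c)) (trace c);
  built_sub : forall i, i \in buyers c -> J i \subset items c;
  built_cover : forall j, j \in items c -> exists2 i, i \in buyers c & j \in J i
}.

(** The last two fields are what makes a finished component closed: once
[checked] is the whole set of items, no buyer left in the pool has an item in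
it. *)
Record search_inv (Ic : {set 'I_n}) (s : search_state m n) : Prop := SearchInv {
  inv_built : well_built (partial s);
  inv_buyers : buyers (partial s) \subset Ic;
  inv_pool : pool s = Ic :\: buyers (partial s);
  inv_checked : checked s \subset items (partial s);
  inv_free : forall i j, i \in pool s -> j \in checked s -> j \notin J i
}.

Lemma search_init_inv (Ic : {set 'I_n}) i :
  i \in Ic -> search_inv Ic (search_init J Ic i).
Proof.
move=> iIc; split=> //=.
- split=> //= [i'|j ji]; first by rewrite inE => /eqP ->.
  by exists i => //; rewrite inE.
- by rewrite finset.sub1set.
- exact: finset.sub0set.
- by move=> ? ? _; rewrite inE.
Qed.

Lemma search_step_inv (Ic : {set 'I_n}) s j :
  search_inv Ic s -> j \in items (partial s) -> search_inv Ic (search_step J s j).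
Proof.
case=> -[itE gr sub cov] bIc poolE chk free jit.
rewrite /search_step; set new := [set i in pool s | j \in J i].
split=> /=.
- split=> /=.
  + by rewrite reached_rcons itE.
  + apply: grounded_rcons; rewrite -?itE // => i.
    by rewrite inE => /andP[].
  + move=> i; rewrite finset.in_setU => /orP[/sub ib|inew].
      exact: fintype.subset_trans ib (finset.subsetUl _ _).
    apply: fintype.subset_trans (finset.subsetUr _ _).
    exact: (finset.bigcup_sup i).
  + move=> g; rewrite finset.in_setU.
    case/orP=> [/cov[i ib gi]|/finset.bigcupP[i inew gi]].
      by exists i => //; rewrite finset.in_setU ib.
    by exists i => //; rewrite finset.in_setU inew orbT.
- rewrite finset.subUset bIc /=; apply/fintype.subsetP => i.
  by rewrite inE poolE finset.in_setD => /andP[/andP[]].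
- by rewrite poolE finset.setDDl.
- rewrite finset.subUset finset.sub1set finset.in_setU jit /=.
  exact: fintype.subset_trans chk (finset.subsetUl _ _).
- move=> i g; rewrite !inE => /andP[inew ip] /predU1P[->|].
    by move: inew; rewrite ip.
  exact: free.
Qed.

Lemma search_loop_inv (Ic : {set 'I_n}) s s' :
  search_loop J s s' -> search_inv Ic s ->
  search_inv Ic s' /\ checked s' = items (partial s').
Proof.
elim=> {s s'} [s np inv|s j s' _ js _ IH inv]; last first.
  by apply/IH/search_step_inv => //; move: js; rewrite finset.in_setD => /andP[].
split=> //; have := inv_checked _ _ inv; rewrite finset.subEproper (negPf np) orbF.
by move/eqP.
Qed.

(** The hypothesis on [Ic] is the loop invariant: a finished component shares
no item with the buyers that are still unassigned. *)
Lemma classification_components (Ic : {set 'I_n}) cs :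
  classify_from J Ic cs ->
  (forall i i', i \notin Ic -> i' \in Ic -> [disjoint J i & J i']) ->
  List.Forall (fun c => well_built c /\
    forall i, i \notin buyers c -> [disjoint J i & items c]) cs /\
  forall i, i \in Ic -> exists2 c, List.In c cs & J i \subset items c.
Proof.
elim=> {Ic cs} [|Ic i0 s cs i0Ic run _ IH] sep.
  by split=> [|i]; [exact: List.Forall_nil|rewrite inE].
have [[bld bIc poolE _ free] chkE] :=
  search_loop_inv Ic _ _ run (search_init_inv Ic i0 i0Ic).
have dis i : i \notin buyers (partial s) -> [disjoint J i & items (partial s)].
  move=> ib; rewrite disjoint_sym disjoint_subset; apply/fintype.subsetP => j js.
  rewrite inE; have [iIc|iIc] := boolP (i \in Ic).
    by apply: free; rewrite ?chkE // poolE finset.in_setD ib.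
  have [i' i'b ji'] := built_cover _ bld j js.
  apply/negP => ji; have := sep i i' iIc (fintype.subsetP bIc _ i'b).
  by move=> /pred0P/(_ j); rewrite /= ji ji'.
have [|Fcs cover] := IH.
  move=> i i' ip i'p; have i'b : i' \notin buyers (partial s).
    by move: i'p; rewrite poolE finset.in_setD => /andP[].
  have i'Ic : i' \in Ic by move: i'p; rewrite poolE finset.in_setD => /andP[].
  have [iIc|iIc] := boolP (i \in Ic); last exact: sep.
  have ib : i \in buyers (partial s).
    by move: ip; rewrite poolE finset.in_setD iIc andbT negbK.
  rewrite disjoint_sym; apply: disjointWr (dis _ i'b).
  exact: (built_sub _ bld).
split=> [|i iIc]; first exact: List.Forall_cons.
have [ib|ib] := boolP (i \in buyers (partial s)).
  by exists (partial s); [left|exact: (built_sub _ bld)].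
by have [|c ? ?] := cover i; [rewrite poolE finset.in_setD ib|exists c => //; right].
Qed.
End Classification.

(** When the items in each [J i] have equal bang per buck, all competing
assignments to an item agree with its log price relative to the first item,
here [q]. *)
Lemma assign_loop_correct (R : realType) (m n : nat) (M : fisher_market R m n)
    (J : 'I_n -> {set item m}) (q : item m -> R) (D : {set item m})
    tr (a a' : item m -> R) :
  (forall i g j, g \in J i -> j \in J i ->
    log_value M i g - log_value M i j = q g - q j) ->
  grounded J D tr -> assign_loop M J D tr a a' ->
  {in D, a =1 q} -> {in reached J D tr, a' =1 q}.
Proof.
move=> qJ; elim: tr D a => [|[j new] tr IH] D a /= => [_ -> //|].
case=> jD newj gr [a1 [asg loop]] aq; apply: (IH _ a1) => // g.
rewrite finset.in_setU => gD; have := asg g; rewrite finset.in_setD.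
have [gD' /= ->|gD' /=] := boolP (g \in D); first exact: aq.
rewrite (negPf gD') /= in gD; rewrite gD => -[i [inew gi ->]].
by rewrite -addrA (qJ i) ?newj // aq // addrC subrK.
Qed.

(** * Exact recovery of the minimizer *)

Section Recovery.
Context {R : realType} {m n : nat} (M : fisher_market R m n).
Implicit Types (mu nu : 'rV[R]_m).

(** The propagated values are log prices relative to [j1]. The base value is
then the log price of [j1]: the item 0 has log price 0, and a component
without it spends all its budget on its own goods. *)
Lemma component_solution_minimizer mu nu c :
  is_minimizer (F M) mu -> well_built (argmax_items M mu) c ->
  (forall i, i \notin buyers c -> [disjoint argmax_items M mu i & items c]) ->
  component_solution M (argmax_items M mu) c nu ->
  forall k, Some k \in items c -> nu 0 k = mu 0 k.
Proof.
move=> mumin [itE gr sub _] dis [j1 [new1 [tr [a [trE loop nuE]]]]] k ks.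
have j1s : j1 \in argmax_items M mu (seed c) by move: gr; rewrite trE /= => -[].
pose q j := log_price mu j - log_price mu j1.
have qJ i g j : g \in argmax_items M mu i -> j \in argmax_items M mu i ->
    log_value M i g - log_value M i j = q g - q j.
  move=> /argmaxP[_ gE] /argmaxP[_]; rewrite -gE /q /log_bang; lra.
have aq : {in items c, a =1 q}.
  rewrite itE; apply: (assign_loop_correct _ _ _ M _ q _ _ _ _ qJ gr loop) => j js.
  rewrite /assign_init js (qJ _ _ _ js j1s) /q; ring.
have j1c : j1 \in items c.
  by rewrite itE; exact: (fintype.subsetP (reached_sub _ _ _)).
suff base : base_value M c a = log_price mu j1.
  by rewrite nuE // base aq // /q addrC subrK.
rewrite /base_value; have [Nc|Nc] := boolP (None \in items c).
  by rewrite aq // /q /= sub0r opprK.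
rewrite -(component_budget M mu _ _ mumin Nc sub dis).
have -> : \sum_(j in items c) expR (a j) =
    (\sum_(j in items c) expR (log_price mu j)) * expR (- log_price mu j1).
  by rewrite mulr_suml; apply: eq_bigr => j jc; rewrite aq // /q expRD.
rewrite lnM ?posrE ?expR_gt0 //; last first.
  by rewrite (bigD1 j1) //= ltr_pwDl ?expR_gt0 // sumr_ge0.
by rewrite expRK; ring.
Qed.

Lemma solution_minimizer mu nu cs : is_minimizer (F M) mu ->
  classification (argmax_items M mu) cs ->
  solution M (argmax_items M mu) cs nu -> nu = mu.
Proof.
move=> mumin cls sol; have [|Fcs cover] := classification_components _ _ _ cls.
  by move=> i i'; rewrite inE.
apply/rowP => k; have [i ki] := minimizer_covers M mu k mumin.
have [//|c cin ic] := cover i.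
have [bld dis] := (List.Forall_forall _ _).1 Fcs c cin.
apply: (component_solution_minimizer mu nu c) => //.
  exact: (List.Forall_forall _ _).1 sol c cin.
exact: (fintype.subsetP ic).
Qed.

Lemma gap_le mu i j : desirable M i j -> j \notin argmax_items M mu i ->
  (gap M mu <= (max_log_bang M mu i - log_bang M mu i j)%:E)%E.
Proof.
move=> dj ji; rewrite /gap; apply: (bigmin_inf i) => //.
rewrite hE EFinB leeB // -[leLHS]/(log_bang M mu i j)%:E.
apply: (bigmax_sup j) => //.
by rewrite log_ratioE dj.
Qed.

Lemma gap_gt0 mu : (0 < gap M mu)%E.
Proof.
apply: lt_bigmin => [|i _]; first exact: ltry.
rewrite hE sube_gt0; apply: bigmax_lt => [|j ji]; first exact: ltNyr.
rewrite log_ratioE; case: ifP => dj; last exact: ltNyr.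
by rewrite lte_fin; exact: max_log_bang_gt.
Qed.

(** Moving by [r] changes each log bang per buck and each maximum by at most
[r]. An optimal item thus loses at most [2 * r] against the maximum, and a
near item was within [4 * r] of it at [mu]. *)
Lemma near_items_argmax mu nu (r : R) :
  (forall k, `|nu 0 k - mu 0 k| <= r) -> ((4 * r)%:E < gap M mu)%E -> 0 <= r ->
  near_items M nu r = argmax_items M mu.
Proof.
move=> close rgap r0.
have lbc i j : `|log_bang M nu i j - log_bang M mu i j| <= r.
  have -> : log_bang M nu i j - log_bang M mu i j =
      log_price mu j - log_price nu j by rewrite /log_bang; ring.
  case: j => [k|] /=; last by rewrite subrr normr0.
  by rewrite distrC.
have le_nu i : max_log_bang M nu i <= max_log_bang M mu i + r.
  apply: max_log_bang_le => j dj; have := le_max_log_bang M mu i j dj.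
  have := lbc i j; rewrite ler_norml => /andP[]; lra.
have le_mu i : max_log_bang M mu i <= max_log_bang M nu i + r.
  apply: max_log_bang_le => j dj; have := le_max_log_bang M nu i j dj.
  have := lbc i j; rewrite ler_norml => /andP[]; lra.
apply/funext => i; apply/setP => j; rewrite [LHS]inE hE log_ratioE.
have [dj|dj] := boolP (desirable M i j); last first.
  by rewrite mem_argmax (negPf dj) /=.
rewrite -EFinB lee_fin.
have := lbc i j; rewrite ler_norml => /andP[lb1 lb2].
have [ji|ji] := boolP (j \in argmax_items M mu i).
  have [_ jE] := argmaxP M ji; have := le_nu i; lra.
have := lt_le_trans rgap (gap_le mu i j dj ji); rewrite lte_fin => gp.
apply/negbTE; rewrite -ltNge; have := le_mu i; lra.
Qed.

(** From the bound on [k], [theta ^+ k <= sigma * g ^+ 2 / 36], so the radius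
is at most [g / sqrt 18], and [4 < sqrt 18]. *)
Lemma radius_lt_gap (theta : R) (k : nat) (g : \bar R) :
  0 < theta < 1 -> (0 < g)%E -> max_iterations M theta g <= k%:Z ->
  ((4 * Num.sqrt (2 * theta ^+ k / sigma M))%:E < g)%E.
Proof.
move=> /andP[th0 th1]; case: g => [d| |] // d0; last by rewrite ltry.
rewrite lte_fin in d0; rewrite /max_iterations ge_max => /andP[kK _].
have : 0 < sigma M := expR_gt0 _.
move: kK; set s := sigma M => kK s0; rewrite lte_fin.
have x0 : 0 < Num.sqrt s * d / 6 by rewrite divr_gt0 // mulr_gt0 // sqrtr_gt0.
have thk : theta ^+ k <= s * d ^+ 2 / 36.
  have -> : s * d ^+ 2 / 36 = (Num.sqrt s * d / 6) ^+ 2.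
    by rewrite -{1}(sqr_sqrtr (ltW s0)); field.
  have lt0 : ln theta < 0 by rewrite ln_lt0 // th0.
  have : 2 * logb theta (Num.sqrt s * d / 6) <= k%:R.
    by apply: le_trans (ceil_ge _) _; rewrite [leRHS]pmulrn ler_int.
  rewrite /logb mulrA ler_ndivrMr // => kln.
  rewrite -ler_ln ?posrE; [|exact: exprn_gt0|exact: exprn_gt0].
  by rewrite !lnXn // -[_ *+ k]mulr_natl -[_ *+ 2]mulr_natl.
have y0 : 2 * theta ^+ k / s < (d / 4) ^+ 2.
  have P0 : 0 < s * d ^+ 2 by rewrite mulr_gt0 ?exprn_gt0.
  by rewrite ltr_pdivrMr //; move: thk; lra.
have := y0; rewrite -ltr_sqrt ?exprn_gt0 ?divr_gt0 // sqrtr_sqr.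
rewrite ger0_norm; last by rewrite divr_ge0 // ltW.
lra.
Qed.

End Recovery.

(** * Number of iterations *)

Lemma stopping_minimizer (R : realType) (m n : nat) (M : fisher_market R m n)
  (mu : 'rV[R]_m) : subdifferential (F M) mu 0 <-> is_minimizer (F M) mu.
Proof.
have sum0 (y : 'rV[R]_m) : \sum_j (0 : 'rV[R]_m) 0 j * (y 0 j - mu 0 j) = 0.
  by apply: big1 => j _; rewrite mxE mul0r.
by split=> H y; have := H y; rewrite /= sum0 adde0.
Qed.

Theorem theorem5p2 (R : realType) (m n : nat) (hm : (1 <= m)%N) (hn : (1 <= n)%N)
    (M : fisher_market R m n) (theta : R) (htheta : 0 < theta < 1)
    (mustar : 'rV[R]_m) (hmustar : is_minimizer (F M) mustar)
    (mus : nat -> 'rV[R]_m) (outs : nat -> option 'rV[R]_m)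
    (hrun : adaptive_apm_run M theta mustar mus outs) :
  exists (k : nat) (muhat : 'rV[R]_m),
    [/\ (1 <= k)%N /\ (k%:Z <= max_iterations M theta (gap M mustar)),
        forall k', (1 <= k' < k)%N -> ~ stopping M (outs k'),
        outs k = Some muhat,
        subdifferential (F M) muhat 0 &
        ce_prices M (map_mx expR muhat)].
Proof.
set K := max_iterations M theta (gap M mustar).
have K1 : 1 <= K.
  rewrite /K /max_iterations; case: (gap M mustar) => // d.
  by rewrite le_max lexx orbT.
have KE : (`|K|%N)%:Z = K by rewrite gez0_abs // (le_trans _ K1).
have K1n : (1 <= `|K|)%N by rewrite -lez_nat KE.
have KleK : K <= (`|K|%N)%:Z by rewrite KE.
have last_stops : (forall k, (1 <= k < `|K|)%N -> ~ stopping M (outs k)) ->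
    stopping M (outs `|K|%N).
  move=> nostop; have [box close rec] := hrun _ K1n nostop.
  set nu := mus `|K|%N in box close rec; set eps := theta ^+ `|K|%N in close rec.
  have th0 : 0 < theta by case/andP: htheta.
  have s0 : 0 < sigma M := expR_gt0 _.
  have [pl0 plp] := p_lowerP M mustar hm hn hmustar.
  have growth := quadratic_growth M mustar nu (sigma M) hmustar.
  have smu k : sigma M <= expR (mustar 0 k).
    apply: le_trans (plp k); rewrite -(lnK pl0) ler_expR /eta /mu_lower.
    by rewrite gerBl.
  have snu k : sigma M <= expR (nu 0 k).
    by rewrite ler_expR; case/andP: (box k).
  have r_close k : `|nu 0 k - mustar 0 k| <= Num.sqrt (2 * eps / sigma M).
    rewrite -sqrtr_sqr ler_sqrt; last by rewrite !mulr_ge0 ?invr_ge0 ?exprn_ge0 ?ltW.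
    rewrite ler_pdivlMr //; have := growth smu snu.
    move: close; rewrite !FE -EFinB lee_fin => close /le_trans/(_ close).
    rewrite (bigD1 k) //=; set S := \sum_(_ | _) _.
    have : 0 <= S by apply: sumr_ge0 => l _; exact: sqr_ge0.
    nra.
  have nearE := near_items_argmax M mustar nu _ r_close
    (radius_lt_gap M theta _ _ htheta (gap_gt0 M mustar) KleK) (sqrtr_ge0 _).
  move: rec; rewrite /recovery nearE ifT; last first.
    apply/forallP => k; apply/existsP; exact: minimizer_covers.
  case=> cs [mu' [cls sol outE]]; exists mu'; first exact: outE.
  apply/stopping_minimizer.
  by rewrite (solution_minimizer M mustar mu' cs hmustar cls sol).
pose stops k := (1 <= k)%N && `[< stopping M (outs k) >].
have exstop : exists k, stops k && (k <= `|K|)%N.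
  have [[k kP]|none] := pselect (exists k, stops k && (k <= `|K|)%N).
    by exists k.
  exists `|K|%N; rewrite leqnn andbT /stops K1n; apply/asboolP/last_stops.
  move=> k /andP[k1 kK] st; apply: none; exists k.
  by rewrite /stops k1 (ltnW kK) andbT; apply/asboolP.
have [k /andP[/andP[k1 /asboolP[muhat outE sub]] kK] kmin] := ex_minnP exstop.
exists k, muhat; split=> //.
- by rewrite -KE lez_nat.
- move=> k' /andP[k'1 k'k] st; have := kmin k'.
  rewrite /stops k'1 (leq_trans (ltnW k'k) kK) andbT leqNgt k'k.
  by move=> /(_ (asboolT st)).
- by apply: minimizer_ce_prices; apply/stopping_minimizer.
Qed.
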